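(* Let $G$ be a finite simple connected graph of order $n>1$ with $\operatorname{diam}(G)=\operatorname{rad}(G)=3$. Then there is at least one vertex $v\in V(G)$ such that either $G\setminus v$ is disconnected, or $W(G\setminus v)<W(G)$.
   Context: For a connected graph $G=(V,E)$, $d_G(u,v)$ denotes the length of a shortest path between $u$ and $v$, and the total distance (Wiener index) $W(G)$ is the sum of $d_G(u,v)$ over all unordered pairs of vertices $\{u,v\}\subseteq V$. The order of $G$ is $|V|$. $\operatorname{diam}(G)=\max_{u,v\in V} d_G(u,v)$ and $\operatorname{rad}(G)=\min_{u\in V}\max_{v\in V} d_G(u,v)$. $G\setminus v$ is the graph obtained from $G$ by deleting the vertex $v$ and its incident edges. *)

(* Defs.v *)
From mathcomp Require Import all_boot.

Set Implicit Arguments.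
Unset Strict Implicit.
Unset Printing Implicit Defensive.

Record sgraph := SGraph {
  vertex :> finType;
  edge : rel vertex;
  edge_sym : symmetric edge;
  edge_irr : irreflexive edge }.

Section Distance.
Variable G : sgraph.
Implicit Types u v : G.

(* [order] is already the orbit length in fingraph, hence [gorder]. *)
Definition gorder : nat := #|G|.

(* The graph without vertices is connected in this sense. *)
Definition connected : bool := [forall u : G, forall v : G, connect (@edge G) u v].

Definition has_path u v (k : nat) : bool :=
  [exists p : k.-tuple G,
     [&& path (@edge G) u p, uniq (u :: p) & last u p == v]].

(* A path has fewer than #|G| edges, so the search range is exhaustive: this is
   the least length of a path from u to v. If there is no such path, [find]
   returns the junk value #|G|. *)
Definition dist u v : nat := find (has_path u v) (iota 0 #|G|).

(* Ordering the vertices by [enum_rank] selects exactly one of (u, v), (v, u)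
   for each unordered pair of distinct vertices. *)
Definition wiener : nat :=
  \sum_(u : G) \sum_(v : G | enum_rank u < enum_rank v) dist u v.

Definition ecc u : nat := \max_(v : G) dist u v.

Definition diam : nat := \max_(u : G) ecc u.

(* Every eccentricity is at most [diam], so starting the iterated minimum from
   [diam] does not change its value on a nonempty graph. *)
Definition rad : nat := \big[minn/diam]_(u : G) ecc u.

End Distance.

Section VertexDeletion.
Variables (G : sgraph) (v : G).

Definition del_edge : rel {x : G | x != v} := fun x y => edge (val x) (val y).

Fact del_edge_sym : symmetric del_edge.
Proof. by move=> x y; apply: edge_sym. Qed.

Fact del_edge_irr : irreflexive del_edge.
Proof. by move=> x; apply: edge_irr. Qed.

Definition del_vertex : sgraph := SGraph del_edge_sym del_edge_irr.

End VertexDeletion.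

(* Main.v *)
Require Import Defs.
From mathcomp Require Import all_boot.
From mathcomp Require Import zify.

Set Implicit Arguments.
Unset Strict Implicit.
Unset Printing Implicit Defensive.

(** Averaging over the deleted vertex: with every eccentricity equal to 3, the
    sum of W(G \ v) over all vertices v is smaller than #|G| * W(G), so some
    term is smaller than W(G).

    Each v has a vertex a at distance 3. A shortest path from any x != v to a
    cannot pass through v, since it would then have length at least 1 + 3,
    more than ecc x = 3. Hence any two vertices other than v are joined
    through a by a walk of length at most 6 that misses v; in particular
    G \ v is connected and its distances are at most 6 ([dist_avoiding_le6]).

    Now fix x != y at distance d and one shortest path between them, and let
    n = #|G|. Of the n - 2 graphs G \ v in which x and y survive, only the
    d - 1 whose v lies inside that path can have a distance other than d, and
    that distance is at most 6. So the distances of x and y in all the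
    G \ v add up to at most (n - 2) * d + (d - 1) * (6 - d), and
    (d - 1) * (6 - d) <= 2 * d for d = 1, 2, 3, strictly for d = 1
    ([sum_dist_avoiding_le]). Summing over all ordered pairs counts every
    Wiener index twice, and an edge of G makes the comparison strict
    ([sum_wiener_del_lt]). *)

(** * Distances and walks *)

Lemma has_pathP (G : sgraph) (x y : G) k :
  reflect (exists p, [/\ path (@edge G) x p, uniq (x :: p), last x p = y
                       & size p = k])
          (has_path x y k).
Proof.
apply: (iffP existsP) => [[p /and3P[pathp uniqp /eqP lastp]]|].
  by exists p; split=> //; apply: size_tuple.
case=> p [pathp uniqp lastp /eqP sizep].
by exists (Tuple sizep); rewrite pathp uniqp lastp eqxx.
Qed.

(** Reversing a path: this gives the symmetry of [dist] even between vertices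
    that are not connected, where [dist] takes its default value. *)
Lemma has_path_sym (G : sgraph) (x y : G) k : has_path x y k = has_path y x k.
Proof.
suff {x y} rev_imp (x y : G) : has_path x y k -> has_path y x k.
  by apply/idP/idP; apply: rev_imp.
move=> /has_pathP[p [pathp uniqp <- <-]].
apply/has_pathP; exists (rev (belast x p)); split.
- by rewrite rev_path (eq_path (e' := @edge G)) // => u v; apply: edge_sym.
- by rewrite -rev_rcons -lastI rev_uniq.
- by case: p {pathp uniqp} => //= z p; rewrite rev_cons last_rcons.
- by rewrite size_rev size_belast.
Qed.

Lemma dist_sym (G : sgraph) (x y : G) : dist x y = dist y x.
Proof. by apply: eq_find => k; apply: has_path_sym. Qed.

Lemma uniq_cons_size_lt (T : finType) (x : T) s :
  uniq (x :: s) -> size s < #|T|.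
Proof. by move=> /card_uniqP size_s; rewrite -[_.+1]size_s max_card. Qed.

(** Removing the loops of a walk leaves a path short enough to lie within the
    search range of [dist]. *)
Lemma dist_le_size (G : sgraph) (x : G) p :
  path (@edge G) x p -> dist x (last x p) <= size p.
Proof.
case/shortenP=> q pathq uniqq subqp.
have size_q : size q <= size p.
  by apply: uniq_leq_size subqp; case/andP: uniqq.
apply: leq_trans size_q; rewrite leqNgt; apply/negP => lt_q.
have ltqG : size q < #|G| by apply: uniq_cons_size_lt uniqq.
have path_q : has_path x (last x q) (size q) by apply/has_pathP; exists q.
by have := before_find 0 lt_q; rewrite nth_iota // add0n path_q.
Qed.

Lemma dist_xx (G : sgraph) (x : G) : dist x x = 0.
Proof. by apply/eqP; rewrite -leqn0; apply: (@dist_le_size G x [::]). Qed.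

Lemma geodesic (G : sgraph) (x y : G) : connect (@edge G) x y ->
  exists p, [/\ path (@edge G) x p, last x p = y & size p = dist x y].
Proof.
case/connectP=> p /shortenP[q pathq uniqq _ ->].
have ltqG : size q < #|G| by apply: uniq_cons_size_lt uniqq.
have has_geo : has (has_path x (last x q)) (iota 0 #|G|).
  apply/hasP; exists (size q); first by rewrite mem_iota.
  by apply/has_pathP; exists q.
have := nth_find 0 has_geo.
rewrite nth_iota; last by rewrite has_find size_iota in has_geo.
by case/has_pathP=> r [pathr _ lastr sizer]; exists r.
Qed.

Lemma dist_gt0 (G : sgraph) (x y : G) :
  connect (@edge G) x y -> x != y -> 0 < dist x y.
Proof.
by case/geodesic=> -[|z p] [_ /= <- <-] //; rewrite eqxx.
Qed.

(** * Wiener index and distances after deleting a vertex *)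

(** Sums over ordered pairs do not depend on the enumeration of the vertices,
    which differs between a graph and its vertex-deleted subgraphs. *)
Lemma double_wiener (G : sgraph) :
  \sum_(x : G) \sum_(y : G) dist x y = (wiener G).*2.
Proof.
rewrite -addnn {2}/wiener [X in _ + X](exchange_big_dep predT) //=.
rewrite -big_split; apply: eq_bigr => x _ /=.
rewrite (bigID (fun y => enum_rank x < enum_rank y)) /=; congr addn.
rewrite [LHS](bigD1 x) ?ltnn //= dist_xx add0n.
apply: eq_big => [y|y _]; last exact: dist_sym.
rewrite -leqNgt [RHS]ltn_neqAle andbC; congr (~~ _ && _).
by rewrite -(inj_eq enum_rank_inj).
Qed.

(** The distance in [del_vertex v], as a function on the vertices of the whole
    graph. The value 0 when x or y is v makes unrestricted sums over G agree
    with sums over [del_vertex v]. *)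
Definition dist_avoiding (G : sgraph) (v x y : G) : nat :=
  if (insub x, insub y) is (Some x', Some y')
  then @dist (del_vertex v) x' y' else 0.

Lemma dist_avoiding_le_size (G : sgraph) (v x : G) p :
  path (@edge G) x p -> v \notin p ->
  dist_avoiding v x (last x p) <= size p.
Proof.
move=> pathp vNp; rewrite /dist_avoiding; case: insubP => // x' xNv def_x.
have [q def_p] : exists q : seq (del_vertex v), p = map val q.
  have : all (fun z => z != v) p.
    by apply/allP=> z zp; apply: contraNneq vNp => <-.
  elim: p {pathp vNp} => [|z p IHp] /=; first by exists [::].
  by case/andP=> zNv /IHp[q ->]; exists (Sub z zNv :: q).
rewrite -def_x def_p last_map valK size_map; apply: dist_le_size.
by move: pathp; rewrite -def_x def_p path_map.
Qed.

Lemma double_wiener_del (G : sgraph) (v : G) :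
  (wiener (del_vertex v)).*2 = \sum_(x : G) \sum_(y : G) dist_avoiding v x y.
Proof.
have sum_del (F : G -> nat) : F v = 0 ->
    \sum_x F x = \sum_(x' : del_vertex v) F (val x').
  move=> Fv0; rewrite (bigD1 v) //= Fv0 add0n.
  exact: (big_sub (fun x => x != v)).
rewrite -double_wiener sum_del; last first.
  by rewrite big1 // => y _; rewrite /dist_avoiding insubF ?eqxx.
apply: eq_bigr => x' _; rewrite sum_del; last first.
  by rewrite /dist_avoiding (insubF _ (x := v)) ?eqxx //; case: insub.
by apply: eq_bigr => y' _; rewrite /dist_avoiding !valK.
Qed.

(** * Shortest paths that miss a vertex *)

Lemma dist_through_le_size (G : sgraph) (x v : G) p :
  path (@edge G) x p -> v \in p ->
  dist x v + dist v (last x p) <= size p.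
Proof.
move=> pathp v_p; move: pathp; case/splitPr: v_p => p1 p2.
rewrite -cat_rcons cat_path last_cat size_cat last_rcons => /andP[path1 path2].
rewrite leq_add ?dist_le_size //.
by rewrite -[v in dist x v](last_rcons x p1 v) dist_le_size.
Qed.

Lemma geodesic_avoiding (G : sgraph) (v x y : G) : connect (@edge G) x y ->
  dist x y < dist x v + dist v y ->
  exists p, [/\ path (@edge G) x p, last x p = y, size p = dist x y
              & v \notin p].
Proof.
case/geodesic=> p [pathp lastp sizep]; rewrite -sizep -lastp => lt_v.
exists p; split=> //; apply: contraL lt_v => v_p.
by rewrite -leqNgt dist_through_le_size.
Qed.

(** * Graphs in which every eccentricity is 3 *)

Section EccentricityThree.

Variable G : sgraph.
Hypotheses (conn_G : connected G) (ecc3 : forall v : G, ecc v = 3).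

Let conn (x y : G) : connect (@edge G) x y.
Proof. by move/forallP: conn_G => /(_ x) /forallP/(_ y). Qed.

Lemma dist_le3 (x y : G) : dist x y <= 3.
Proof. by rewrite -(ecc3 x) /ecc leq_bigmax. Qed.

Lemma exists_dist3 (v : G) : exists a, dist v a = 3.
Proof.
have G_gt0 : 0 < #|G| by apply/card_gt0P; exists v.
have [a def_a] := eq_bigmax (dist v) G_gt0.
by exists a; rewrite -def_a; apply: ecc3.
Qed.

(** Detour through a vertex a with dist v a = 3: a shortest path between a and
    a vertex other than v has length at most 3, which leaves no room for v. *)
Lemma dist_avoiding_le6 (v x y : G) : v != x -> v != y ->
  dist_avoiding v x y <= 6.
Proof.
move=> vNx vNy; have [a dva] := exists_dist3 v.
have xv_gt0 : 0 < dist x v by rewrite dist_gt0 // eq_sym.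
have vy_gt0 := dist_gt0 (conn v y) vNy.
have [p [pathp lastp sizep vNp]] : exists p,
    [/\ path (@edge G) x p, last x p = a, size p = dist x a & v \notin p].
  by apply: geodesic_avoiding => //; have := dist_le3 x a; lia.
have [q [pathq lastq sizeq vNq]] : exists q,
    [/\ path (@edge G) a q, last a q = y, size q = dist a y & v \notin q].
  apply: geodesic_avoiding => //.
  by have := dist_le3 a y; rewrite [dist a v]dist_sym; lia.
have le_pq : dist_avoiding v x (last x (p ++ q)) <= size (p ++ q).
  apply: dist_avoiding_le_size; first by rewrite cat_path pathp lastp.
  by rewrite mem_cat negb_or vNp.
move: le_pq; rewrite last_cat lastp lastq size_cat sizep sizeq.
by have := dist_le3 x a; have := dist_le3 a y; lia.
Qed.

(** Only the interior vertices of one fixed shortest path can change the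
    distance from x to y when deleted. With d = dist x y, they add at most
    (d - 1) * (6 - d), while the two vanishing terms v = x and v = y save
    2 * d; the saving is strictly larger when d = 1. *)
Lemma sum_dist_avoiding_le (x y : G) :
  \sum_(v : G) dist_avoiding v x y + (dist x y == 1) <= #|G| * dist x y.
Proof.
have av_x (z : G) : dist_avoiding x x z = 0.
  by rewrite /dist_avoiding insubF ?eqxx.
have av_y (z : G) : dist_avoiding y z y = 0.
  by rewrite /dist_avoiding (insubF _ (x := y)) ?eqxx //; case: insub.
have [<-|xNy] := eqVneq x y.
  rewrite dist_xx muln0 addn0 big1 // => v _.
  rewrite /dist_avoiding; case: insub => // x'; exact: dist_xx.
have [p [pathp lastp sizep]] := geodesic (conn x y).
case/lastP: p => [|p z] in pathp lastp sizep *.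
  by rewrite /= in lastp; rewrite lastp eqxx in xNy.
rewrite last_rcons in lastp; subst z; rewrite size_rcons in sizep.
(* Here p lists the interior vertices of the path, and d = size p + 1. *)
have le_v v : v != x -> v != y ->
    dist_avoiding v x y <= dist x y + (v \in p) * (6 - dist x y).
  move=> vNx vNy; case: (boolP (v \in p)) => v_p; last first.
    rewrite mul0n addn0 -sizep -(size_rcons p y).
    rewrite -[y in dist_avoiding _ _ y](last_rcons x p).
    by apply: dist_avoiding_le_size; rewrite // mem_rcons in_cons negb_or vNy.
  rewrite mul1n subnKC ?dist_avoiding_le6 //.
  by apply: leq_trans (dist_le3 x y) _.
have sum_p : \sum_(v : G | (v != x) && (v != y)) (v \in p) <= size p.
  apply: leq_trans (card_size p).
  rewrite -sum1_card big_mkcond [leqRHS]big_mkcond.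
  by apply: leq_sum => v _; case: (v \in p); case: ifP.
have card_G : #|G| = #|[pred v | (v != x) && (v != y)]| + 2.
  rewrite (cardD1 x) (cardD1 y) !inE [y == x]eq_sym xNy addn2 !add1n.
  by congr _.+2; apply: eq_card => v; rewrite !inE andbT andbC.
have : \sum_(v : G) dist_avoiding v x y <=
       #|[pred v | (v != x) && (v != y)]| * dist x y
       + size p * (6 - dist x y).
  rewrite (bigD1 x) //= av_x (bigD1 y) ?(eq_sym y) //= av_y !add0n.
  apply: leq_trans (leq_add (leqnn _) (leq_mul sum_p (leqnn _))).
  rewrite -sum_nat_const big_distrl -big_split /=.
  by apply: leq_sum => v /andP[vNx vNy]; apply: le_v.
rewrite card_G; have := dist_le3 x y; rewrite -sizep mulnDl.
by case: (size p) => [|[|[|k]]] //=; lia.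
Qed.

Lemma exists_dist1 : 0 < #|G| -> exists x y : G, dist x y = 1.
Proof.
case/card_gt0P=> x _; have [a dxa] := exists_dist3 x.
have [[|z p] [/= pathp _ sizep]] := geodesic (conn x a).
  by rewrite dxa in sizep.
case/andP: pathp => xz _; exists x, z; apply/eqP; rewrite eqn_leq.
rewrite (@dist_le_size G x [:: z]) /= ?xz // dist_gt0 //.
by apply: contraTneq xz => <-; rewrite edge_irr.
Qed.

Lemma sum_wiener_del_lt : 0 < #|G| ->
  \sum_(v : G) wiener (del_vertex v) < #|G| * wiener G.
Proof.
move=> G_gt0; rewrite -ltn_double doubleMr -double_wiener -muln2 big_distrl /=.
under eq_bigr do rewrite muln2 double_wiener_del.
(* Bring the sum over the deleted vertex inside, for each ordered pair. *)
rewrite exchange_big big_distrr /=.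
under eq_bigr do rewrite exchange_big.
under [ltnRHS]eq_bigr do rewrite big_distrr.
rewrite pair_bigA [ltnRHS]pair_bigA /=.
have [x [y dxy]] := exists_dist1 G_gt0.
rewrite (bigD1 (x, y)) // [ltnRHS](bigD1 (x, y)) //= -addSn.
apply: leq_add; first by have := sum_dist_avoiding_le x y; rewrite {1}dxy addn1.
apply: leq_sum => xy _.
exact: leq_trans (leq_addr _ _) (sum_dist_avoiding_le _ _).
Qed.

End EccentricityThree.

Lemma rad_le_ecc (G : sgraph) (v : G) : rad G <= ecc v.
Proof.
rewrite /rad; elim: (index_enum G) (mem_index_enum v) => // u s IHs.
by rewrite in_cons big_cons geq_min => /predU1P[<-|/IHs->];
  rewrite ?leqnn ?orbT.
Qed.

Theorem proposition5 (G : sgraph) (order_gt1 : 1 < gorder G)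
  (conn_G : connected G) (diam_G : diam G = 3) (rad_G : rad G = 3) :
  exists v : G,
    ~~ connected (del_vertex v) \/ wiener (del_vertex v) < wiener G.
Proof.
have ecc3 (v : G) : ecc v = 3.
  apply/eqP; rewrite eqn_leq -{1}diam_G -rad_G rad_le_ecc andbT.
  exact: (@leq_bigmax _ (@ecc G)).
have lt_sum := sum_wiener_del_lt conn_G ecc3 (ltnW order_gt1).
have [v lt_v|no_v] := pickP (fun v : G => wiener (del_vertex v) < wiener G).
  by exists v; right.
move: lt_sum; rewrite ltnNge -sum_nat_const leq_sum // => v _.
by rewrite leqNgt no_v.
Qed.
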